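(* Let $n$ be a positive integer and let $R$ be a commutative associative ring with unity. The following are equivalent: (1) Every matrix in $M_n(R)$ is a sum of $2$-nd powers of matrices in $M_n(R)$. (2) Every matrix in $M_n(R)$ is a sum of $4$-th powers of matrices in $M_n(R)$. (3) Every matrix in $M_n(R)$ is a sum of $8$-th powers of matrices in $M_n(R)$. (4) Every matrix in $M_n(R)$ is a sum of $16$-th powers of matrices in $M_n(R)$. (5) Every element of $R$ is a $2$-nd power modulo $2R$, i.e. for every $r\in R$ there is $a\in R$ with $r-a^2\in 2R$. In particular, if $R$ is an order in an algebraic number field, then these conditions are further equivalent to $(2,\operatorname{disc} R)=1$. Moreover, for $M\in M_n(R)$: (6) if $\operatorname{tr}(M)\in W^*(2,4,R)$, then $M$ is a sum of $16$-th powers of matrices in $M_n(R)$.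
   Context: $M_n(R)$ is the ring of $n\times n$ matrices over $R$ and $\operatorname{tr}$ is the trace. A ''sum of $k$-th powers of matrices in $M_n(R)$'' means a finite sum $\sum_{i=1}^{l} M_i^k$ with $M_i\in M_n(R)$ (any finite number of terms). $\mathbb{N}$ denotes the positive integers. For a prime $p$ and a positive integer $s$, $$W(p,s,R):=\{a_0^{p^s}+pa_1^{p^{s-1}}+p^2a_2^{p^{s-2}}+\cdots+p^sa_s\mid a_0,a_1,\dots,a_s\in R\}.$$ Set $W^*(2,4,R):=\bar W(2,4,R)\cup W(2,5,R)$, where $$\bar W(2,4,R):=\{a_0^{16}+2a_1^8+4a^4+16a+16a^{2m+1}\mid a_0,a_1,a\in R,\ m\in\mathbb{N}\}.$$ An order $R$ in an algebraic number field $K$ is a subring of $K$ containing the identity which is a $\mathbb{Z}$-module of maximal rank $\deg(K/\mathbb{Q})$; $\operatorname{disc} R$ is its discriminant, and $(a,b)$ denotes the greatest common divisor.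
   Formalization: The matrix size n is assumed to be at least 2: for n = 1 the claim is false, since with R = Z every integer is a square mod 2 and disc R = 1, but -1 (which lies in W(2,5,Z)) is not a sum of squares or of 16th powers. *)

(* Defs.v *)
From HB Require Import structures.
From mathcomp Require Import all_boot all_order all_algebra all_field.

Set Implicit Arguments.
Unset Strict Implicit.
Unset Printing Implicit Defensive.

Import Order.TTheory GRing.Theory Num.Theory.
Local Open Scope ring_scope.

(* Rings are [comPzRingType]s, so the zero ring is not excluded. *)

(* The empty sum is harmless: it equals the one-term sum 0 ^+ k for k > 0. *)
Definition sum_of_powers (R : comPzRingType) (n k : nat) (M : 'M[R]_n) : Prop :=
  exists s : seq 'M[R]_n, M = \sum_(X <- s) X ^+ k.

Definition all_sums_of_powers (R : comPzRingType) (n k : nat) : Prop :=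
  forall M : 'M[R]_n, sum_of_powers k M.

Definition all_squares_mod2 (R : comPzRingType) : Prop :=
  forall r : R, exists a b : R, r - a ^+ 2 = 2%:R * b.

Definition W (p s : nat) (R : comPzRingType) (x : R) : Prop :=
  exists a : 'I_s.+1 -> R,
    x = \sum_(i < s.+1) p%:R ^+ i * a i ^+ (p ^ (s - i))%N.

Definition Wbar24 (R : comPzRingType) (x : R) : Prop :=
  exists (a0 a1 a : R) (m : nat), (0 < m)%N /\
    x = a0 ^+ 16 + 2%:R * a1 ^+ 8 + 4%:R * a ^+ 4
        + 16%:R * a + 16%:R * a ^+ (2 * m + 1)%N.

Definition Wstar24 (R : comPzRingType) (x : R) : Prop :=
  Wbar24 x \/ W 2 5 x.

(* A number field is a [fieldExtType rat], i.e. a finite extension of rat. *)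

(* Tr_{K/Q}(x): the trace of the Q-linear endomorphism y |-> x * y of K. *)
Definition field_trace (K : fieldExtType rat) (x : K) : rat :=
  \sum_(i < \dim {:K}) coord (vbasis {:K}) i (x * (vbasis {:K})`_i).

Definition is_Zbasis (V : zmodType) (d : nat) (e : 'I_d -> V) : Prop :=
  forall v : V, exists! c : {ffun 'I_d -> int}, v = \sum_(i < d) e i *~ c i.

(* The subring R of K is given by its inclusion [iota].  A Z-submodule of     *)
(* maximal rank is, as usual for orders (and as is needed for disc R to make  *)
(* sense), a finitely generated, hence free, one of rank [K : Q].             *)
Definition is_order (K : fieldExtType rat) (R : comPzRingType)
    (iota : {rmorphism R -> K}) : Prop :=
  injective iota /\ exists e : 'I_(\dim {:K}) -> R, is_Zbasis e.

(* The discriminant computed in a Z-basis [e] of R.  The determinant is a     *)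
(* rational integer, [numq] only moves it from [rat] to [int]; it does not    *)
(* depend on the choice of [e].                                               *)
Definition disc (K : fieldExtType rat) (R : comPzRingType)
    (iota : {rmorphism R -> K}) (e : 'I_(\dim {:K}) -> R) : int :=
  numq (\det (\matrix_(i, j) field_trace (iota (e i) * iota (e j)))).

(* Main.v *)
Require Import Defs.
From HB Require Import structures.
From mathcomp Require Import all_boot all_order all_algebra all_field.
From mathcomp Require Import all_fingroup ring.

(* Over any R, a matrix of trace 0 is a sum of 16th powers: x E_ij is a sum   *)
(* of the idempotent E_ii + x E_ij and of - E_ii, and - E_ii - E_jj = w + w^2 *)
(* with w of order 3.  So only the set T of traces of sums of 16th powers     *)
(* matters.  It is an additive group containing tr(A^16), a polynomial in     *)
(* t = tr A and d = det A, for all t and d.  Integer combinations of values   *)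
(* of this polynomial give 32R in T; modulo 32 it reduces to                  *)
(* 16d + 8d^2 + 20d^4 + 16d^6, whose polarizations put in T the remaining     *)
(* terms of the forms W(2,5,R) and W(2,4,R).  If every element of R is a      *)
(* square modulo 2, iterating r = a^2 + 2b writes every element in the first  *)
(* form; conversely tr(A^2) = tr(A)^2 modulo 2.                               *)
(*                                                                            *)
(* For an order of rank d, (5) says that the Frobenius of R/2R is onto, hence *)
(* bijective.  If disc R is odd, the trace form is nondegenerate modulo 2 and *)
(* R/2R is reduced because tr(zy)^2 = tr((zy)^2) modulo 2.  If some power     *)
(* x -> x^q of the Frobenius is the identity, the multiplication matrices     *)
(* over a field with q elements are killed by X^q - X, so they are            *)
(* simultaneously diagonalizable, and the Gram matrix of the trace form is    *)
(* L L^T with L invertible.                                                   *)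

Set Implicit Arguments.
Unset Strict Implicit.
Unset Printing Implicit Defensive.

Import Order.TTheory GRing.Theory Num.Theory.
Local Open Scope ring_scope.

(** * Subgroups containing the traces of 16th powers *)

(** [sum_of_powers_tr] reduces membership to traces, [trace_sum16_subgroup] makes the attained
    traces a group, and [subgroup_trpow16_Wbar24] and [subgroup_trpow16_Witt] find enough elements
    in it. The conditions on powers all meet in squares modulo 2: [all_sums_of_squares_mod2] leads
    there, [all_sums_of_powers16] leads back, and smaller exponents follow by divisibility. For
    orders, [odd_disc_all_squares] and [all_squares_odd_disc] are the two directions. *)

Definition subgroup (V : zmodType) (T : V -> Prop) : Prop :=
  T 0 /\ forall x y, T x -> T y -> T (x - y).

Lemma subgroupN (V : zmodType) (T : V -> Prop) x :
  subgroup T -> T x -> T (- x).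
Proof. by move=> [T0 TB] Tx; rewrite -[- x]add0r; apply: TB. Qed.

Lemma subgroupD (V : zmodType) (T : V -> Prop) x y :
  subgroup T -> T x -> T y -> T (x + y).
Proof.
by move=> gT Tx Ty; rewrite -[y]opprK; apply: gT.2 => //; apply: subgroupN.
Qed.

Lemma subgroupMn (V : zmodType) (T : V -> Prop) x m :
  subgroup T -> T x -> T (x *+ m).
Proof.
move=> gT Tx; elim: m => [|m IHm]; first by rewrite mulr0n; apply: gT.1.
by rewrite mulrS; apply: subgroupD.
Qed.

(* Replacing g(x) by g(2x) - 2^k g(x) removes the degree k term of g and      *)
(* multiplies the coefficients of lower degree by nonzero integers.           *)
Lemma subgroup_poly_mult (R : comPzRingType) (T : R -> Prop) (k : nat)
    (c : nat -> int) :
  subgroup T -> c 1 != 0 ->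
  (forall x, T (\sum_(i < k.+2) x ^+ i *~ c i)) ->
  exists2 N, (0 < N)%N & forall x, T (x *+ N).
Proof.
move=> gT; elim: k c => [|k IHk] c c1 Tc.
  exists `|c 1|%N => [|x]; first by rewrite lt0n absz_eq0.
  have Tcx : T (x *~ c 1).
    have := gT.2 _ _ (Tc x) (Tc 0).
    rewrite !big_ord_recr !big_ord0 /= !add0r !expr0 !expr1 mul0rz addr0.
    by rewrite addrAC subrr add0r.
  move: (c 1) Tcx => [] m //; rewrite NegzE mulrNz => Tcx.
  by rewrite -[_ *+ _]opprK; apply: subgroupN.
apply: (IHk (fun i => c i * ((2 ^ i)%N%:Z - (2 ^ k.+2)%N%:Z))).
  by rewrite mulf_neq0 // subr_eq0 eqz_nat eqn_exp2l.
move=> x; have := gT.2 _ _ (Tc (x *+ 2)) (subgroupMn (2 ^ k.+2) gT (Tc x)).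
rewrite !(big_ord_recr k.+2) /= mulrnDl opprD addrACA.
rewrite [X in _ + X](_ : _ = 0) ?addr0; last first.
  by rewrite exprMn_n !pmulrn -!mulrzA mulrC subrr.
rewrite -sumrMnl -sumrB; congr T; apply: eq_bigr => i _.
by rewrite exprMn_n !pmulrn -!mulrzA -mulrzBr mulrBr mulrC.
Qed.

(** Negatives come for free: -y = (N - 1) y + N (-y), and both terms lie in [T]. *)
Lemma addclosed_subgroup (V : zmodType) (T : V -> Prop) (N : nat) :
  T 0 -> (forall x y, T x -> T y -> T (x + y)) ->
  (0 < N)%N -> (forall x, T (x *+ N)) -> subgroup T.
Proof.
move=> T0 TD; case: N => // N _ TN; split=> // x y Tx Ty.
have -> : x - y = x + (y *+ N + (- y) *+ N.+1).
  by rewrite mulrS (addrCA (y *+ N)) -mulrnDl subrr mul0rn addr0.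
do 2![apply: (TD) => //].
by elim: N {TN} => [|N IHN] //; rewrite mulrS; apply: TD.
Qed.

(* The trace of the 16th power of a 2 x 2 matrix of trace t and determinant d.*)
Definition trpow16 (R : comPzRingType) (t d : R) : R :=
  (((t ^+ 2 - 2%:R * d) ^+ 2 - 2%:R * d ^+ 2) ^+ 2 - 2%:R * d ^+ 4) ^+ 2
  - 2%:R * d ^+ 8.

Lemma addclosed_trpow16_subgroup (R : comPzRingType) (T : R -> Prop) :
  T 0 -> (forall x y, T x -> T y -> T (x + y)) ->
  (forall t d, T (trpow16 t d)) -> subgroup T.
Proof.
move=> T0 TD Tp; pose S x := T x /\ T (- x).
have gS : subgroup S.
  split; first by split; rewrite ?oppr0.
  by move=> x y [Tx TNx] [Ty TNy]; split; rewrite ?opprB; [|rewrite addrC];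
     apply: TD; rewrite ?opprK.
have S16 x : S (x ^+ 16).
  split; first by have := Tp x 0; congr T; rewrite /trpow16; ring.
  (* The eigenvalues are x times the two primitive cube roots of unity, so the trace is - x^16. *)
  by have := Tp (- x) (x ^+ 2); congr T; rewrite /trpow16; ring.
have [||N N_gt0 SN] := @subgroup_poly_mult R S 15 (fun i => 'C(16, i)%:Z) gS.
- by [].
- move=> x; have := S16 (x + 1); congr S; rewrite addrC exprDn.
  by apply: eq_bigr => i _; rewrite expr1n mul1r.
by apply: (addclosed_subgroup T0 TD N_gt0) => x; case: (SN x).
Qed.

Lemma subgroup_trpow16_mul32 (R : comPzRingType) (T : R -> Prop) :
  subgroup T -> (forall t d, T (trpow16 t d)) -> forall x, T (32%:R * x).
Proof.
move=> gT Tp.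
(* Differences odd in x isolate 96x. The even part of [f] then gives 32x^2 modulo 96R, polarization
   turns this into 64x, and 96 - 64 = 32. *)
pose f (d : R) := trpow16 1 d - trpow16 0 d.
have Tf d : T (f d) by apply: gT.2.
have T96 x : T (96%:R * x).
  pose h b := trpow16 1 (b + x) - trpow16 1 (b - x).
  have Th b : T (h b) by apply: gT.2.
  (* The coefficients were found by lattice reduction. *)
  have -> : 96%:R * x = h (- 3%:R) *+ 6 - h (- 2%:R) *+ 52 - h (- 1) + h 0 *+ 18
      + h 1 *+ 85 - h 2%:R *+ 101 + h 3%:R *+ 150.
    by rewrite /h /trpow16; ring.
  by do ![apply: subgroupMn => // | apply: gT.2 => // | apply: subgroupD => //].
have T32sq x : T (32%:R * x ^+ 2).
  have -> : 32%:R * x ^+ 2 = (f x + f (- x)) *+ 32 - trpow16 1 0 *+ 64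
      - 96%:R * (69%:R * x ^+ 2 + 440%:R * x ^+ 4 + 224%:R * x ^+ 6).
    by rewrite /f /trpow16; ring.
  apply: gT.2 => //; apply: gT.2; apply: subgroupMn => //.
  exact: subgroupD.
move=> x.
have -> : 32%:R * x = 96%:R * x - (32%:R * (x + 1) ^+ 2 - 32%:R * x ^+ 2
                                   - 32%:R * 1 ^+ 2) by ring.
by do ![apply: gT.2 => //].
Qed.

Lemma subgroup_trpow16_generators (R : comPzRingType) (T : R -> Prop) :
  subgroup T -> (forall t d, T (trpow16 t d)) ->
  [/\ forall x, T (16%:R * x ^+ 2),
      forall x, T (16%:R * x ^+ 3 + 8%:R * x ^+ 2),
      forall x, T (4%:R * x ^+ 4 + 16%:R * x + 16%:R * x ^+ 3)
    & forall x, T (8%:R * x ^+ 4)].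
Proof.
move=> gT Tp; have T32 := subgroup_trpow16_mul32 gT Tp.
pose g (d : R) := 16%:R * d + 8%:R * d ^+ 2 + 20%:R * d ^+ 4 + 16%:R * d ^+ 6.
have Tg d : T (g d).
  have -> : g d = trpow16 1 d - trpow16 0 d - trpow16 1 0
     + 32%:R * (d - 3%:R * d ^+ 2 + 11%:R * d ^+ 3 - 20%:R * d ^+ 4
                + 21%:R * d ^+ 5 - 10%:R * d ^+ 6 + 2%:R * d ^+ 7).
    by rewrite /g /trpow16; ring.
  by apply: subgroupD => //; do ![apply: gT.2 => //].
(* Modulo 32, [D y] is 16y^4 + 16y^3 + 8y^2; doubling it leaves 16y^2. *)
pose D y := g (y + 1) - g y - g 1.
have TD y : T (D y) by do ![apply: gT.2 => //].
have T16 y : T (16%:R * y ^+ 2).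
  have -> : 16%:R * y ^+ 2 = D y *+ 2 - 32%:R * (6%:R * y ^+ 5 + 15%:R * y ^+ 4
      + 25%:R * y ^+ 3 + 22%:R * y ^+ 2 + 12%:R * y) by rewrite /D /g; ring.
  by apply: gT.2 => //; apply: subgroupMn.
have T8 y : T (16%:R * y ^+ 3 + 8%:R * y ^+ 2).
  have -> : 16%:R * y ^+ 3 + 8%:R * y ^+ 2 = D y - (16%:R * (y ^+ 2) ^+ 2) *+ 15
      - 32%:R * (3%:R * y ^+ 5 + 12%:R * y ^+ 3 + 11%:R * y ^+ 2 + 6%:R * y).
    by rewrite /D /g; ring.
  by do ![apply: gT.2 => //]; apply: subgroupMn.
have T4 y : T (4%:R * y ^+ 4 + 16%:R * y + 16%:R * y ^+ 3).
  have -> : 4%:R * y ^+ 4 + 16%:R * y + 16%:R * y ^+ 3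
      = g y - 16%:R * (y ^+ 2) ^+ 2 - 16%:R * (y ^+ 3) ^+ 2
        - (16%:R * y ^+ 3 + 8%:R * y ^+ 2) + 32%:R * y ^+ 3 by rewrite /g; ring.
  by apply: subgroupD => //; do ![apply: gT.2 => //].
split=> // y.
have -> : 8%:R * y ^+ 4 = (4%:R * y ^+ 4 + 16%:R * y + 16%:R * y ^+ 3) *+ 2
   - 32%:R * (y + y ^+ 3) by ring.
by apply: gT.2 => //; apply: subgroupMn.
Qed.

Lemma subgroup_trpow16_Wbar24 (R : comPzRingType) (T : R -> Prop) :
  subgroup T -> (forall t d, T (trpow16 t d)) -> forall x, Wbar24 x -> T x.
Proof.
move=> gT Tp _ [a0 [a1 [a [m [m_gt0 ->]]]]].
have T32 := subgroup_trpow16_mul32 gT Tp.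
have [T16 T8 T4 _] := subgroup_trpow16_generators gT Tp.
have T16yz (y z : R) : T (16%:R * (y ^+ 2 * z + y * z ^+ 2 + y * z)).
  pose P (u : R) := 16%:R * u ^+ 3 + 8%:R * u ^+ 2.
  have -> : 16%:R * (y ^+ 2 * z + y * z ^+ 2 + y * z) = P (y + z) - P y - P z
      - 32%:R * (y ^+ 2 * z + y * z ^+ 2) by rewrite /P; ring.
  by do ![apply: gT.2 => //]; apply: T8.
have TaDodd : T (4%:R * a ^+ 4 + 16%:R * a + 16%:R * a ^+ (2 * m + 1)).
  case: m m_gt0 => // m _; elim: m => [|m IHm]; first exact: T4.
  (* [T16yz] at y = a^2 and z = a^(2m+1) raises the odd exponent by 2, up to 16 times a square and
     multiples of 32. *)
  have -> : 4%:R * a ^+ 4 + 16%:R * a + 16%:R * a ^+ (2 * m.+2 + 1)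
    = 4%:R * a ^+ 4 + 16%:R * a + 16%:R * a ^+ (2 * m.+1 + 1)
      + 16%:R * ((a ^+ 2) ^+ 2 * a ^+ (2 * m).+1
                 + a ^+ 2 * (a ^+ (2 * m).+1) ^+ 2 + a ^+ 2 * a ^+ (2 * m).+1)
      - 16%:R * (a * a ^+ (2 * m).+1) ^+ 2
      - 32%:R * (a ^+ 2 * a ^+ (2 * m).+1).
    have -> : (2 * m.+2 + 1 = 4 + (2 * m).+1)%N by rewrite !mulnS addn1.
    have -> : (2 * m.+1 + 1 = 2 + (2 * m).+1)%N by rewrite !mulnS addn1.
    by rewrite !exprD; ring.
  by do ![apply: gT.2 => //]; apply: subgroupD.
have -> : a0 ^+ 16 + 2%:R * a1 ^+ 8 + 4%:R * a ^+ 4 + 16%:R * a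
    + 16%:R * a ^+ (2 * m + 1) = trpow16 a0 0 + trpow16 0 a1
    + (4%:R * a ^+ 4 + 16%:R * a + 16%:R * a ^+ (2 * m + 1)).
  by rewrite /trpow16; ring.
by do ![apply: subgroupD => //].
Qed.

(** The exponents 16, 8, 8, 4, 2 are lower than in W(2,5,R) for a0 and a1: squares in these two
    places give W(2,5,R), and iterating r = a^2 + 2b gives this form directly. *)
Lemma subgroup_trpow16_Witt (R : comPzRingType) (T : R -> Prop) :
  subgroup T -> (forall t d, T (trpow16 t d)) -> forall a0 a1 a2 a3 a4 a5,
  T (a0 ^+ 16 + 2%:R * a1 ^+ 8 + 4%:R * a2 ^+ 8 + 8%:R * a3 ^+ 4
     + 16%:R * a4 ^+ 2 + 32%:R * a5).
Proof.
move=> gT Tp a0 a1 a2 a3 a4 a5.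
have T32 := subgroup_trpow16_mul32 gT Tp.
have [T16 _ _ T8] := subgroup_trpow16_generators gT Tp.
have -> : a0 ^+ 16 = trpow16 a0 0 by rewrite /trpow16; ring.
have -> : 2%:R * a1 ^+ 8 = trpow16 0 a1 by rewrite /trpow16; ring.
have -> : 4%:R * a2 ^+ 8 = trpow16 0 a2 *+ 2 by rewrite /trpow16; ring.
by do ![apply: subgroupD => //]; apply: subgroupMn.
Qed.

(** * Sums of 16th powers of matrices *)

Lemma expr_idem (R : pzSemiRingType) (x : R) k :
  x * x = x -> (0 < k)%N -> x ^+ k = x.
Proof.
by move=> xx; case: k => // k _; elim: k => // k IHk; rewrite exprS IHk.
Qed.

Lemma sum_of_powers0 (R : comPzRingType) n k : sum_of_powers k (0 : 'M[R]_n).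
Proof. by exists [::]; rewrite big_nil. Qed.

Lemma sum_of_powersX (R : comPzRingType) n k (X : 'M[R]_n) :
  sum_of_powers k (X ^+ k).
Proof. by exists [:: X]; rewrite big_seq1. Qed.

Lemma sum_of_powersD (R : comPzRingType) n k (X Y : 'M[R]_n) :
  sum_of_powers k X -> sum_of_powers k Y -> sum_of_powers k (X + Y).
Proof. by move=> [s ->] [t ->]; exists (s ++ t); rewrite big_cat. Qed.

Lemma sum_of_powers_sum (R : comPzRingType) n k (I : finType)
    (F : I -> 'M[R]_n) :
  (forall i, sum_of_powers k (F i)) -> sum_of_powers k (\sum_i F i).
Proof.
by move=> SF; apply: big_ind => //;
   [exact: sum_of_powers0 | exact: sum_of_powersD].
Qed.

Lemma sum_of_powers_idem (R : comPzRingType) n k (X : 'M[R]_n) :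
  (0 < k)%N -> X *m X = X -> sum_of_powers k X.
Proof.
by move=> k_gt0 XX; rewrite -(expr_idem XX k_gt0); apply: sum_of_powersX.
Qed.

Definition mx2 (R : comPzRingType) n (i j : 'I_n) (a b c d : R) : 'M[R]_n :=
  a *: delta_mx i i + b *: delta_mx i j + c *: delta_mx j i + d *: delta_mx j j.

Section Mx2.

Variables (R : comPzRingType) (n : nat) (i j : 'I_n).
Hypothesis neq_ij : i != j.
Implicit Types a b c d : R.

Local Notation E := (@mx2 R n i j).

Lemma mx2M a b c d a' b' c' d' :
  E a b c d *m E a' b' c' d'
  = E (a * a' + b * c') (a * b' + b * d')
            (c * a' + d * c') (c * b' + d * d').
Proof.
have neq_ji : j != i by rewrite eq_sym.
rewrite /mx2 !mulmxDl !mulmxDr -!scalemxAl -!scalemxAr !scalerA.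
rewrite !mul_delta_mx_cond.
rewrite !eqxx (negbTE neq_ij) (negbTE neq_ji) !mulr0n !mulr1n !scaler0.
rewrite !addr0 !add0r !scalerDl.
by apply/matrixP => u v; rewrite !mxE; ring.
Qed.

Lemma mx2D a b c d a' b' c' d' :
  E a b c d + E a' b' c' d'
  = E (a + a') (b + b') (c + c') (d + d').
Proof. by apply/matrixP => u v; rewrite !mxE; ring. Qed.

Lemma mxtrace_mx2 a b c d : \tr (E a b c d) = a + d.
Proof.
have tr_delta u v : \tr (delta_mx u v : 'M[R]_n) = (u == v)%:R.
  rewrite /mxtrace (bigD1 u) //= big1 ?addr0 => [|w /negPf neq_wu];
    by rewrite mxE ?eqxx ?neq_wu //= eq_sym.
rewrite !raddfD /= !mxtraceZ !tr_delta !eqxx (negPf neq_ij).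
by rewrite eq_sym (negPf neq_ij) /=; ring.
Qed.

Lemma mxtrace_mx2_exp16 t d :
  \tr (E t (- d) 1 0 ^+ 16) = trpow16 t d.
Proof.
rewrite -[16%N]/(2 * 2 * 2 * 2)%N !exprM !expr2 -!mulmxE !mx2M mxtrace_mx2.
by rewrite /trpow16; ring.
Qed.

Local Notation S := (@sum_of_powers R n 16).

Lemma sum_of_powers_idem_mx2 a b c d :
  a * a + b * c = a -> a * b + b * d = b ->
  c * a + d * c = c -> c * b + d * d = d -> S (E a b c d).
Proof.
by move=> Ea Eb Ec Ed; apply: sum_of_powers_idem; rewrite ?mx2M ?Ea ?Eb ?Ec ?Ed.
Qed.

(* [omega] has order 3 in the corner, so that [omega + omega^2 + 1 = 0] there *)
(* and both [omega] and [omega^2] are their own 16th powers.                  *)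
Lemma sum_of_powers_opp1_mx2 : S (E (-1) 0 0 (-1)).
Proof.
pose omega := E 0 (-1) 1 (-1).
have omega2 : omega ^+ 2 = E (-1) 1 (-1) 0.
  by rewrite expr2 -mulmxE mx2M; congr mx2; ring.
have omega4 : omega ^+ 4 = omega.
  by rewrite -[4%N]/(2 * 2)%N exprM omega2 expr2 -mulmxE mx2M; congr mx2; ring.
have omega16 : omega ^+ 16 = omega.
  by rewrite -[16%N]/(4 * 4)%N exprM !omega4.
have -> : E (-1) 0 0 (-1) = omega ^+ 16 + (omega ^+ 2) ^+ 16.
  by rewrite exprAC omega16 omega2 mx2D; congr mx2; ring.
by apply: sum_of_powersD; apply: sum_of_powersX.
Qed.

Lemma sum_of_powers_opp_delta : S (E (-1) 0 0 0).
Proof.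
have -> : E (-1) 0 0 0 = E (-1) 0 0 (-1) + E 0 0 0 1.
  by rewrite mx2D; congr mx2; ring.
apply: sum_of_powersD; first exact: sum_of_powers_opp1_mx2.
by apply: sum_of_powers_idem_mx2; ring.
Qed.

Lemma sum_of_powers_offdiag x : S (E 0 x 0 0).
Proof.
have -> : E 0 x 0 0 = E 1 x 0 0 + E (-1) 0 0 0.
  by rewrite mx2D; congr mx2; ring.
apply: sum_of_powersD; last exact: sum_of_powers_opp_delta.
by apply: sum_of_powers_idem_mx2; ring.
Qed.

End Mx2.

Lemma mx2C (R : comPzRingType) n (i j : 'I_n) (a b c d : R) :
  mx2 i j a b c d = mx2 j i d c b a.
Proof. by apply/matrixP => u v; rewrite !mxE; ring. Qed.

Lemma sum_of_powers_diag (R : comPzRingType) n (i j : 'I_n) (x : R) :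
  i != j -> sum_of_powers 16 (mx2 i j x 0 0 (- x)).
Proof.
move=> neq_ij; have neq_ji : j != i by rewrite eq_sym.
(* the first summand is idempotent *)
have -> : mx2 i j x 0 0 (- x) = mx2 i j x (x - 1) (- x) (1 - x)
    + mx2 j i (-1) 0 0 0 + mx2 i j 0 (1 - x) 0 0 + mx2 j i 0 x 0 0.
  by rewrite !(mx2C j) !mx2D; congr mx2; ring.
apply: sum_of_powersD; last exact: sum_of_powers_offdiag.
apply: sum_of_powersD; last exact: sum_of_powers_offdiag.
apply: sum_of_powersD; last exact: sum_of_powers_opp_delta.
by apply: sum_of_powers_idem_mx2 => //; ring.
Qed.

Lemma sum_of_powers_tr0 (R : comPzRingType) n (M : 'M[R]_n) :
  \tr M = 0 -> sum_of_powers 16 M.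
Proof.
case: n M => [|n] M trM0; first by rewrite flatmx0; apply: sum_of_powers0.
(* The subtracted terms add up to tr(M) E_00 = 0, while each summand on its own has trace 0. *)
have -> : M = \sum_i \sum_j (M i j *: delta_mx i j
                             - ((i == j)%:R * M i j) *: delta_mx 0 0).
  under eq_bigr do rewrite sumrB.
  rewrite sumrB -matrix_sum_delta [X in _ - X](_ : _ = \tr M *: delta_mx 0 0).
    by rewrite trM0 scale0r subr0.
  rewrite scaler_suml; apply: eq_bigr => i _; rewrite (bigD1 i) //= eqxx mul1r.
  rewrite big1 ?addr0 // => j /negPf; rewrite eq_sym => ->.
  by rewrite mul0r scale0r.
apply: sum_of_powers_sum => i; apply: sum_of_powers_sum => j.
have [<-|neq_ij] := eqVneq i j; last first.
  have := sum_of_powers_offdiag neq_ij (M i j); congr sum_of_powers.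
  by rewrite /mx2 mul0r !scale0r !(addr0, add0r, subr0).
have [->|neq_i0] := eqVneq i 0.
  by rewrite mul1r subrr; apply: sum_of_powers0.
have := sum_of_powers_diag (M i i) neq_i0; congr sum_of_powers.
by rewrite /mx2 mul1r !scale0r !addr0 scaleNr.
Qed.

Lemma sum_of_powers_tr (R : comPzRingType) n (M N : 'M[R]_n) :
  \tr M = \tr N -> sum_of_powers 16 N -> sum_of_powers 16 M.
Proof.
move=> trMN SN; rewrite -(subrK N M); apply: sum_of_powersD => //.
by apply: sum_of_powers_tr0; rewrite raddfB /= trMN subrr.
Qed.

Definition trace_sum16 (R : comPzRingType) n (x : R) : Prop :=
  exists2 M : 'M[R]_n, sum_of_powers 16 M & \tr M = x.

Lemma trace_sum16_trpow16 (R : comPzRingType) n (t d : R) :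
  (1 < n)%N -> trace_sum16 n (trpow16 t d).
Proof.
case: n => [|[|n]] // _.
exists (mx2 ord0 ord_max t (- d) 1 0 ^+ 16); first exact: sum_of_powersX.
exact: mxtrace_mx2_exp16.
Qed.

Lemma trace_sum16_subgroup (R : comPzRingType) n :
  (1 < n)%N -> subgroup (@trace_sum16 R n).
Proof.
move=> n_gt1; apply: addclosed_trpow16_subgroup.
- by exists 0; [exact: sum_of_powers0 | rewrite mxtrace0].
- move=> _ _ [M SM <-] [N SN <-]; exists (M + N); last exact: raddfD.
  exact: sum_of_powersD.
- by move=> t d; apply: trace_sum16_trpow16.
Qed.

Lemma Wstar24_trace_sum16 (R : comPzRingType) n (x : R) :
  (1 < n)%N -> Wstar24 x -> trace_sum16 n x.
Proof.
move=> n_gt1; have gT := @trace_sum16_subgroup R n n_gt1.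
have Tp t d := @trace_sum16_trpow16 R n t d n_gt1.
case=> [|[a ->]]; first exact: subgroup_trpow16_Wbar24.
pose b k := a (inord k).
have := subgroup_trpow16_Witt gT Tp (b 0 ^+ 2) (b 1 ^+ 2) (b 2) (b 3) (b 4) (b 5).
congr trace_sum16.
under [RHS]eq_bigr => i _ do rewrite -[i in a i]inord_val -/(b i).
rewrite !big_ord_recr big_ord0 /= /b /=.
ring.
Qed.

(** * Squares modulo 2 and traces *)

Lemma all_squares_mod2_exp (R : comPzRingType) (k : nat) (r : R) :
  all_squares_mod2 R -> exists a b : R, r = a ^+ (2 ^ k) + 2%:R * b.
Proof.
move=> sqR; elim: k r => [|k IHk] r; first by exists r, 0; ring.
have [a [b /eqP]] := sqR r; rewrite subr_eq => /eqP ->.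
have [c [d ->]] := IHk a.
exists c, (b + 2%:R * d ^+ 2 + 2%:R * d * c ^+ (2 ^ k)).
by rewrite expnS mulnC exprM; ring.
Qed.

Lemma all_squares_mod2_trace_sum16 (R : comPzRingType) n (x : R) :
  (1 < n)%N -> all_squares_mod2 R -> trace_sum16 n x.
Proof.
move=> n_gt1 sqR; have gT := @trace_sum16_subgroup R n n_gt1.
have Tp t d := @trace_sum16_trpow16 R n t d n_gt1.
have [a0 [r0 ->]] := all_squares_mod2_exp 4 x sqR.
have [a1 [r1 ->]] := all_squares_mod2_exp 3 r0 sqR.
have [a2 [r2 ->]] := all_squares_mod2_exp 3 r1 sqR.
have [a3 [r3 ->]] := all_squares_mod2_exp 2 r2 sqR.
have [a4 [r4 ->]] := all_squares_mod2_exp 1 r3 sqR.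
have := subgroup_trpow16_Witt gT Tp a0 a1 a2 a3 a4 r4.
by congr trace_sum16; ring.
Qed.

(** The difference is the sum of the [g i j], which are symmetric in i and j and vanish for i = j,
    hence twice the sum over i < j. *)
Lemma mxtrace_sqr_mod2 (R : comPzRingType) n (M : 'M[R]_n) :
  exists b, \tr (M ^+ 2) = \tr M ^+ 2 + 2%:R * b.
Proof.
pose g (i j : 'I_n) := M i j * M j i - M i i * M j j.
exists (\sum_(i < n) \sum_(j < n | (i < j)%N) g i j).
have -> : 2%:R * (\sum_(i < n) \sum_(j < n | (i < j)%N) g i j) = \sum_i \sum_j g i j.
  rewrite mulr_natl mulr2n {2}(exchange_big_dep xpredT) //= -big_split /=.
  apply: eq_bigr => i _; rewrite [RHS](bigID (fun j : 'I_n => (i < j)%N)) /=.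
  congr (_ + _); rewrite [RHS](bigD1 i) ?ltnn //= [X in X + _](_ : _ = 0) ?add0r.
    apply: eq_big => [j | j _]; last by rewrite /g; ring.
    by rewrite -leqNgt ltn_neqAle andbC.
  exact: subrr.
apply/eqP; rewrite addrC -subr_eq; apply/eqP.
rewrite !expr2 -mulmxE /mxtrace mulr_suml -sumrB; apply: eq_bigr => i _.
by rewrite mxE mulr_sumr -sumrB.
Qed.

Lemma all_sums_of_squares_mod2 (R : comPzRingType) n :
  (0 < n)%N -> all_sums_of_powers R n 2 -> all_squares_mod2 R.
Proof.
case: n => // n _ sumR r; have [s] := sumR (r *: delta_mx 0 0).
move=> /(congr1 mxtrace); rewrite mxtraceZ.
have -> : \tr (delta_mx 0 0 : 'M[R]_n.+1) = 1.
  rewrite /mxtrace (bigD1 0) //= big1 ?addr0 => [|w /negPf neq_w0];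
    by rewrite mxE ?neq_w0.
rewrite mulr1 => ->; elim: s => [|X s [a [b IHs]]].
  by exists 0, 0; rewrite big_nil mxtrace0; ring.
have [c trX2] := mxtrace_sqr_mod2 X.
exists (\tr X + a), (c + b - \tr X * a).
move/eqP: IHs; rewrite subr_eq => /eqP IHs.
by rewrite big_cons mxtraceD IHs trX2; ring.
Qed.

Lemma sum_of_powers_dvd (R : comPzRingType) n k l (M : 'M[R]_n) :
  (l %| k)%N -> sum_of_powers k M -> sum_of_powers l M.
Proof.
move=> /dvdnP[q ->] [s ->]; exists [seq X ^+ q | X <- s].
by rewrite big_map; apply: eq_bigr => X _; rewrite exprM.
Qed.

Lemma all_sums_of_powers16 (R : comPzRingType) n :
  (1 < n)%N -> all_squares_mod2 R -> all_sums_of_powers R n 16.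
Proof.
move=> n_gt1 sqR M.
have [N SN trN] := all_squares_mod2_trace_sum16 (\tr M) n_gt1 sqR.
exact: sum_of_powers_tr (esym trN) SN.
Qed.

(** * Multiplication matrices modulo 2 *)

Section Coordinates.

Variables (R : comPzRingType) (d : nat) (e : 'I_d -> R).
Hypothesis basis_e : is_Zbasis e.

(** Boolean equality lets [xchoose] extract the coordinates. *)
Fact Zcoord_exists v : exists c : {ffun 'I_d -> int}, v == \sum_i e i *~ c i.
Proof. by have [c [/eqP def_v _]] := basis_e v; exists c. Qed.

Definition Zcoord v : 'rV[int]_d := \row_i xchoose (Zcoord_exists v) i.

Lemma Zcoord_sum v : v = \sum_i e i *~ Zcoord v 0 i.
Proof.
rewrite {1}(eqP (xchooseP (Zcoord_exists v))).
by apply: eq_bigr => i _; rewrite mxE.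
Qed.

Lemma Zcoord_unique v (r : 'rV[int]_d) : v = \sum_i e i *~ r 0 i -> Zcoord v = r.
Proof.
move=> def_v; have [c [_ c_unique]] := basis_e v.
have c_eq (r' : 'rV[int]_d) : v = \sum_i e i *~ r' 0 i -> r' = \row_i c i.
  move=> def_v'; rewrite (c_unique [ffun i => r' 0 i]).
    by apply/rowP => i; rewrite mxE ffunE.
  by under eq_bigr do rewrite ffunE.
by rewrite (c_eq _ def_v) -(c_eq _ (Zcoord_sum v)).
Qed.

Lemma Zcoord_is_zmod_morphism : zmod_morphism Zcoord.
Proof.
move=> x y; apply: Zcoord_unique; rewrite {1}(Zcoord_sum x) {1}(Zcoord_sum y).
by rewrite -sumrB; apply: eq_bigr => i _; rewrite !mxE mulrzBr.
Qed.

HB.instance Definition _ :=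
  GRing.isZmodMorphism.Build R 'rV[int]_d Zcoord Zcoord_is_zmod_morphism.

Lemma Zcoord_basis i : Zcoord (e i) = delta_mx 0 i.
Proof.
apply: Zcoord_unique; rewrite (bigD1 i) //= mxE !eqxx mulr1z big1 ?addr0 // => j.
by move=> /negPf neq_ji; rewrite mxE neq_ji.
Qed.

Definition Zmulmx x : 'M[int]_d := \matrix_i Zcoord (x * e i).

Lemma ZcoordM (x y : R) : Zcoord (x * y) = Zcoord y *m Zmulmx x.
Proof.
rewrite {1}(Zcoord_sum y) mulr_sumr raddf_sum mulmx_sum_row /=.
apply: eq_bigr => i _; rewrite mulrzAr raddfMz /= rowK.
by rewrite -[in RHS](intz (Zcoord y 0 i)) scaler_int.
Qed.

Lemma Zmulmx_is_zmod_morphism : zmod_morphism Zmulmx.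
Proof.
by move=> x y; apply/row_matrixP => i; rewrite raddfB /= !rowK mulrBl raddfB.
Qed.

Lemma Zmulmx_is_monoid_morphism : monoid_morphism Zmulmx.
Proof.
split; first by apply/row_matrixP => i; rewrite rowK mul1r Zcoord_basis row1.
move=> x y; apply/row_matrixP => i.
(* Row vectors reverse products; commutativity of [R] restores the order. *)
by rewrite mulrC rowK -mulrA ZcoordM -mulmxE row_mul rowK.
Qed.

HB.instance Definition _ :=
  GRing.isZmodMorphism.Build R 'M[int]_d Zmulmx Zmulmx_is_zmod_morphism.
HB.instance Definition _ :=
  GRing.isMonoidMorphism.Build R 'M[int]_d Zmulmx Zmulmx_is_monoid_morphism.

Definition Ztrace_form : 'M[int]_d := \matrix_(i, j) \tr (Zmulmx (e i * e j)).

Lemma Zcoord_trace_form (x : R) j :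
  (Zcoord x *m Ztrace_form) 0 j = \tr (Zmulmx (x * e j)).
Proof.
rewrite [in RHS](Zcoord_sum x) mulr_suml !raddf_sum mxE; apply: eq_bigr => i _.
by rewrite !mxE mulrzAl !raddfMz /= -mulrzr intz mulrC.
Qed.

Lemma Zcoord_even (x : R) :
  (forall i, (2 %| Zcoord x ord0 i)%Z) <-> exists b, x = 2%:R * b.
Proof.
split=> [even_x | [b ->] i]; last first.
  apply/dvdzP; exists (Zcoord b 0 i).
  by rewrite mulr_natl raddfMn /= mulmxnE pmulrn mulrzz.
exists (\sum_i e i *~ (Zcoord x ord0 i %/ 2)%Z).
rewrite {1}(Zcoord_sum x) mulr_natl -sumrMnl; apply: eq_bigr => i _.
by rewrite -[in LHS](divzK (even_x i)) mulrzA.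
Qed.

Lemma dvdz2_mul (a b : int) : (2 %| a * b)%Z = (2 %| a)%Z || (2 %| b)%Z.
Proof. by rewrite !dvdzE abszM Euclid_dvdM. Qed.

(* If z^2 is in 2R, then tr(zy)^2 = tr((zy)^2) = 0 mod 2 for all y.           *)
Lemma odd_disc_reduced_mod2 (z : R) :
  ~~ (2 %| \det Ztrace_form)%Z ->
  (exists b, z ^+ 2 = 2%:R * b) -> exists b, z = 2%:R * b.
Proof.
move=> odd_det [b z2]; apply/Zcoord_even.
have even_tr j : (2 %| (Zcoord z *m Ztrace_form)%R ord0 j)%Z.
  rewrite Zcoord_trace_form; set A := Zmulmx _.
  have [c trA2] := mxtrace_sqr_mod2 A.
  suff: (2 %| \tr A ^+ 2)%Z by rewrite expr2 dvdz2_mul orbb.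
  have -> : \tr A ^+ 2 = 2 * (\tr (Zmulmx (b * e j ^+ 2)) - c).
    rewrite mulrBr mulr_natl -!raddfMn -mulr_natl /= mulrA -z2 -exprMn rmorphXn.
    by rewrite trA2 addrK.
  exact: dvdz_mulr.
(* The adjugate replaces an inverse of the trace form modulo 2. *)
move=> i; have : (2 %| (\det Ztrace_form * Zcoord z 0 i)%R)%Z.
  have -> : \det Ztrace_form * Zcoord z 0 i
      = (Zcoord z *m Ztrace_form *m \adj Ztrace_form) 0 i.
    by rewrite -mulmxA mul_mx_adj mul_mx_scalar [RHS]mxE.
  rewrite mxE; apply: (big_ind (fun x => (2 %| x)%Z)) => // [x y|j _].
    exact: rpredD.
  exact: dvdz_mulr.
by rewrite dvdz2_mul (negPf odd_det).
Qed.

Definition red2 (x : R) : 'rV['F_2]_d := map_mx intr (Zcoord x).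

Definition lift2 (v : 'rV['F_2]_d) : R := \sum_i e i *+ v 0 i.

Lemma intr_F2_eq0 (a : int) : (a%:~R == 0 :> 'F_2) = (2 %| a)%Z.
Proof. by rewrite -(dvdz_pcharf (pchar_Fp (isT : prime 2))). Qed.

Lemma red2_eq (x y : R) : red2 x = red2 y <-> exists b, x = y + 2%:R * b.
Proof.
have -> : (exists b, x = y + 2%:R * b) <-> (exists b, x - y = 2%:R * b).
  by split=> -[b Eb]; exists b; [rewrite Eb addrC addKr | rewrite -Eb addrC subrK].
rewrite -Zcoord_even; split=> [/rowP red2_xy i | even_xy].
  rewrite raddfB /= !mxE -intr_F2_eq0 rmorphB /= subr_eq0; apply/eqP.
  by have := red2_xy i; rewrite !mxE.
apply/rowP => i; apply/eqP; rewrite !mxE -subr_eq0 -rmorphB intr_F2_eq0.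
by have := even_xy i; rewrite raddfB /= !mxE.
Qed.

Lemma lift2K : cancel lift2 red2.
Proof.
move=> v; have -> : red2 (lift2 v) = map_mx intr (\row_i (v 0 i : nat)%:Z).
  congr map_mx; apply: Zcoord_unique.
  by apply: eq_bigr => i _; rewrite mxE.
by apply/rowP => i; rewrite !mxE -pmulrn natr_Zp.
Qed.

(** The Frobenius of R/2R, carried to a finite set so that injective and surjective agree. *)
Definition frob2 (v : 'rV['F_2]_d) : 'rV['F_2]_d := red2 (lift2 v ^+ 2).

Lemma frob2_red2 (x : R) : frob2 (red2 x) = red2 (x ^+ 2).
Proof.
have /red2_eq[b xE] := lift2K (red2 x); apply/red2_eq; rewrite xE.
by exists (2%:R * x * b + 2%:R * b ^+ 2); ring.
Qed.

(** Since (x - y)^2 = x^2 - y^2 modulo 2, reducedness makes the Frobenius injective, hence onto. *)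
Lemma odd_disc_all_squares :
  ~~ (2 %| \det Ztrace_form)%Z -> all_squares_mod2 R.
Proof.
move=> odd_det r.
have frob2_inj : injective frob2.
  move=> v w; rewrite -[v]lift2K -[w]lift2K !frob2_red2; set x := lift2 v.
  set y := lift2 w => /red2_eq[b xyE]; apply/red2_eq.
  have [|c xyc] := @odd_disc_reduced_mod2 (x - y) odd_det.
    by exists (b + y ^+ 2 - x * y); rewrite sqrrB xyE; ring.
  by exists c; rewrite -xyc addrC subrK.
have [g _ gK] := injF_bij frob2_inj.
have /red2_eq[b xE] : red2 r = red2 (lift2 (g (red2 r)) ^+ 2) by rewrite -/(frob2 _) gK.
by exists (lift2 (g (red2 r))), b; rewrite {1}xE addrC addKr.
Qed.

(** A surjective Frobenius permutes a finite set; [m] is the order of this permutation. *)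
Lemma all_squares_frob2_period :
  all_squares_mod2 R ->
  exists2 m, (0 < m)%N & forall x : R, exists b, x ^+ (2 ^ m) = x + 2%:R * b.
Proof.
move=> sqR.
have frob2_surj v : exists u, frob2 u == v.
  have [a [b /eqP]] := sqR (lift2 v); rewrite subr_eq addrC => /eqP abE.
  by exists (red2 a); rewrite frob2_red2 -[v]lift2K; apply/eqP/esym/red2_eq; exists b.
have gK : cancel (fun v => xchoose (frob2_surj v)) frob2.
  by move=> v; apply/eqP/(xchooseP (frob2_surj v)).
have frob2_inj := can_inj (canF_sym gK).
pose s := perm frob2_inj; exists #[s]%g => [|x]; first exact: order_gt0.
apply/red2_eq; rewrite -[RHS]perm1 -(expg_order s) permX.
elim: #[s]%g => [|m IHm] /=; first by rewrite expn0 expr1.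
by rewrite -IHm permE frob2_red2 expnSr exprM.
Qed.

End Coordinates.

(** [A] is a root of X^q - X, which is a product of distinct linear factors over [F]. *)
Lemma expr_card_diagonalizable (F : finFieldType) n (A : 'M[F]_n) :
  A ^+ #|F| = A -> diagonalizable A.
Proof.
case: n A => [|n] A AqA.
  by exists 1%:M; rewrite ?unitmx1 //; apply/is_diag_mxP => -[].
apply/diagonalizableP; exists (enum F); first exact: enum_uniq.
apply: mxminpoly_min; rewrite big_enum /= -finField_genPoly.
by rewrite rmorphB rmorphXn /= horner_mx_X AqA subrr.
Qed.

(* In a common eigenbasis the Gram matrix of the trace form is L L^T, where   *)
(* the rows of L are the spectra of the N i.                                  *)
Lemma codiagonalizable_trace_form (F : fieldType) n (N : 'I_n -> 'M[F]_n)
    (u : 'rV[F]_n) :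
  codiagonalizable [seq N i | i : 'I_n] ->
  (forall i, u *m N i = delta_mx 0 i) ->
  \det (\matrix_(i, j) \tr (N i *m N j)) != 0.
Proof.
move=> [P Pu /allP diagN] uN.
pose L := \matrix_(i, k) (P *m N i *m invmx P) k k.
have NE i : N i = invmx P *m diag_mx (row i L) *m P.
  have /(@diagonalizable_forP _ _ P (N i) Pu) diagNi : diagonalizable_for P (N i).
    by apply: diagN; apply: image_f.
  suff -> : diag_mx (row i L) = P *m N i *m invmx P.
    by rewrite !mulmxA mulVmx // mul1mx mulmxKV.
  apply/matrixP => k l; rewrite [LHS]mxE [row _ _ _ _]mxE [L _ _]mxE.
  by have [<-|/diagNi ->] := eqVneq k l.
have L_unit : L \in unitmx.
  rewrite -row_free_unit; apply: inj_row_free => w wL.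
  have : \sum_i w 0 i *: N i = 0.
    have -> : \sum_i w 0 i *: N i = invmx P *m diag_mx (w *m L) *m P.
      rewrite mulmx_sum_row linear_sum mulmx_sumr mulmx_suml.
      by apply: eq_bigr => i _; rewrite NE linearZ -scalemxAr -scalemxAl.
    by rewrite wL linear0 mulmx0 mul0mx.
  (* Applying [u] to the relation reads off [w], so [w] = 0. *)
  move=> /(congr1 (mulmx u)); rewrite mulmx0 mulmx_sumr => <-.
  by rewrite [LHS]row_sum_delta; apply: eq_bigr => i _; rewrite -scalemxAr uN.
have -> : \matrix_(i, j) \tr (N i *m N j) = L *m L^T.
  apply/matrixP => i j; rewrite !mxE {1}(NE i) mxtrace_mulC (NE j).
  rewrite !mulmxA mulmxK // -!mulmxA mxtrace_mulC !mulmxA mulmxK // mulmx_diag.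
  by rewrite /mxtrace; apply: eq_bigr => k _; rewrite !mxE eqxx mulr1n mulrC.
by rewrite det_mulmx det_tr mulf_neq0 // -unitfE -unitmxE.
Qed.

Lemma all_squares_odd_disc (R : comPzRingType) d (e : 'I_d -> R)
    (basis_e : is_Zbasis e) :
  all_squares_mod2 R -> ~~ (2 %| \det (Ztrace_form basis_e))%Z.
Proof.
move=> /(all_squares_frob2_period basis_e)[m m_gt0 frobR].
have [F charF cardF] := pPrimePowerField (isT : prime 2) m_gt0.
have even0 (a : int) : (2 %| a)%Z -> a%:~R = 0 :> F.
  by rewrite (dvdz_pcharf charF) => /eqP.
pose N x : 'M[F]_d := map_mx intr (Zmulmx basis_e x).
have NM x y : N (x * y) = N x *m N y by rewrite /N rmorphM -map_mxM.
have NX x k : N (x ^+ k) = N x ^+ k.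
  elim: k => [|k IHk]; first by rewrite /N rmorph1 map_mx1.
  by rewrite !exprS NM IHk.
have Nfrob x : N x ^+ #|F| = N x.
  rewrite cardF -NX; have [b ->] := frobR x.
  rewrite mulr_natl /N raddfD raddfMn /= map_mxD [X in _ + X](_ : _ = 0) ?addr0 //.
  apply/matrixP => i j; rewrite [LHS]mxE [RHS]mxE mulmxnE /= even0 //.
  by rewrite pmulrn mulrzz dvdz_mull.
apply/negP => /even0 /eqP; apply/negP.
have -> : (\det (Ztrace_form basis_e))%:~R
    = \det (\matrix_(i, j) \tr (N (e i) *m N (e j))).
  rewrite -det_map_mx; congr (\det _); apply/matrixP => i j.
  by rewrite !mxE -NM trace_map_mx.
(* The coordinates of 1 serve as [u], because 1 * e i = e i. *)
apply: (@codiagonalizable_trace_form _ _ _ (map_mx intr (Zcoord basis_e 1))).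
  apply/codiagonalizableP; split=> [_ _ /mapP[i _ ->] /mapP[j _ ->]|_ /mapP[i _ ->]].
    by rewrite /comm_mx -!NM mulrC.
  exact: expr_card_diagonalizable.
by move=> i; rewrite -map_mxM -ZcoordM mulr1 Zcoord_basis map_delta_mx.
Qed.

(** * Discriminants of orders *)

Section Orders.

Variables (K : fieldExtType rat) (R : comPzRingType) (iota : {rmorphism R -> K}).
Hypothesis iota_inj : injective iota.
Variable e : 'I_(\dim {:K}) -> R.
Hypothesis basis_e : is_Zbasis e.

Let X := [tuple iota (e i) | i < \dim {:K}].

Let XE (i : 'I_(\dim {:K})) : X`_i = iota (e i).
Proof. by rewrite -tnth_nth tnth_mktuple. Qed.

Lemma Zbasis_free : free X.
Proof.
apply/freeP => k sum_kX i.
(* Clearing denominators turns a rational relation into an integral one, which [iota_inj] pulls back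
   to [R]. *)
pose D := \prod_j denq (k j).
have D_neq0 : D != 0 by apply/prodf_neq0 => j _; apply: denq_neq0.
have /fin_all_exists[z zE] : forall j, exists z : int, D%:~R * k j = z%:~R.
  move=> j.
  exists (numq (k j) * \prod_(l | l != j) denq (k l)).
  by rewrite /D (bigD1 j) //= !rmorphM /= numqE; ring.
have z0 : 0 = \sum_j e j *~ (\row_j z j) 0 j.
  apply: iota_inj; rewrite rmorph0 raddf_sum.
  transitivity (D%:~R *: \sum_i k i *: X`_i); first by rewrite sum_kX scaler0.
  rewrite scaler_sumr.
  apply: eq_bigr => j _; rewrite raddfMz /= mxE scalerA zE XE.
  by rewrite scaler_int.
have := Zcoord_unique basis_e z0; rewrite raddf0 => /rowP/(_ i); rewrite !mxE => zi0.
have := zE i; rewrite -zi0 => /eqP.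
by rewrite mulf_eq0 intr_eq0 (negPf D_neq0) => /eqP.
Qed.

Lemma Zbasis_basis : basis_of {:K} X.
Proof. by rewrite basisEfree Zbasis_free subvf size_tuple leqnn. Qed.

(** Independence of the basis, as tr(AB) = tr(BA) for the two coordinate changes. *)
Lemma field_trace_basis (x : K) :
  field_trace x = \sum_(i < \dim {:K}) coord X i (x * X`_i).
Proof.
pose b := vbasis {:K}.
transitivity (\sum_(i < \dim {:K}) \sum_(j < \dim {:K})
                coord X j (x * b`_i) * coord b i X`_j).
  apply: eq_bigr => i _.
  rewrite -/b {1}(coord_basis Zbasis_basis (memvf (x * b`_i))) linear_sum.
  by apply: eq_bigr => j _; rewrite linearZ.
rewrite exchange_big; apply: eq_bigr => j _ /=.
rewrite [X in _ = coord _ _ (_ * X)](coord_vbasis (memvf X`_j)) mulr_sumr linear_sum.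
by apply: eq_bigr => i _; rewrite -scalerAr linearZ mulrC.
Qed.

Lemma field_trace_Zmulmx (x : R) :
  field_trace (iota x) = (\tr (Zmulmx basis_e x))%:~R.
Proof.
rewrite field_trace_basis raddf_sum; apply: eq_bigr => i _ /=.
rewrite XE -rmorphM {1}(Zcoord_sum basis_e (x * e i)) raddf_sum mxE /=.
rewrite -(coord_sum_free (fun j => (Zcoord basis_e (x * e i) 0 j)%:~R) i Zbasis_free).
by congr coord; apply: eq_bigr => j _; rewrite raddfMz XE scaler_int.
Qed.

Lemma disc_Ztrace_form : disc iota e = \det (Ztrace_form basis_e).
Proof.
rewrite /disc -[RHS]numq_int -det_map_mx; congr (numq (\det _)).
by apply/matrixP => i j; rewrite !mxE -rmorphM field_trace_Zmulmx.
Qed.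

Lemma all_squares_mod2_disc : all_squares_mod2 R <-> gcdz 2 (disc iota e) = 1.
Proof.
have -> : gcdz 2 (disc iota e) = 1 <-> ~~ (2 %| \det (Ztrace_form basis_e))%Z.
  rewrite disc_Ztrace_form (rwP eqP) -/(coprimez _ _) coprimezE dvdzE.
  by rewrite prime_coprime.
split; [exact: all_squares_odd_disc | exact: odd_disc_all_squares].
Qed.

End Orders.

Theorem theorem1p4 (n : nat) (hn : (1 < n)%N) (R : comPzRingType) :
  [<-> all_sums_of_powers R n 2;
       all_sums_of_powers R n 4;
       all_sums_of_powers R n 8;
       all_sums_of_powers R n 16;
       all_squares_mod2 R]
  /\ (forall (K : fieldExtType rat) (iota : {rmorphism R -> K}),
        is_order iota ->
        forall e : 'I_(\dim {:K}) -> R, is_Zbasis e ->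
        [<-> all_sums_of_powers R n 2;
             all_sums_of_powers R n 4;
             all_sums_of_powers R n 8;
             all_sums_of_powers R n 16;
             all_squares_mod2 R;
             gcdz 2 (disc iota e) = 1])
  /\ (forall M : 'M[R]_n, Wstar24 (\tr M) -> sum_of_powers 16 M).
Proof.
have dvd k l : (l %| k)%N -> all_sums_of_powers R n k -> all_sums_of_powers R n l.
  by move=> dvd_lk sumk M; apply: sum_of_powers_dvd dvd_lk (sumk M).
have from2 : all_sums_of_powers R n 2 -> all_squares_mod2 R.
  exact: all_sums_of_squares_mod2 (ltnW hn).
have to16 := all_sums_of_powers16 hn.
have equiv : [<-> all_sums_of_powers R n 2; all_sums_of_powers R n 4;
    all_sums_of_powers R n 8; all_sums_of_powers R n 16; all_squares_mod2 R].
  tfae.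
  - by move/from2/to16; apply: dvd.
  - by move/(dvd 4 2 isT)/from2/to16; apply: dvd.
  - by move/(dvd 8 2 isT)/from2/to16.
  - by move/(dvd 16 2 isT)/from2.
  - by move/to16; apply: dvd.
split; [exact: equiv | split=> [K iota [iota_inj _] e basis_e | M]].
  have disc_equiv := all_squares_mod2_disc iota_inj basis_e.
  tfae.
  - by move/(equiv 0%N 1%N).
  - by move/(equiv 1%N 2%N).
  - by move/(equiv 2%N 3%N).
  - by move/(equiv 3%N 4%N).
  - by move/disc_equiv.
  - by move/disc_equiv/(equiv 4%N 0%N).
move/(Wstar24_trace_sum16 hn) => [N SN trN].
exact: sum_of_powers_tr (esym trN) SN.
Qed.
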